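(* Let $d\ge2$ and let $\boldsymbol{X}=(X_1,\dots,X_d)$ be a random vector with values in $\mathbb{R}_+^d$ and joint cdf $F_{\boldsymbol{X}}(\boldsymbol{x})=C(F_{X_1}(x_1),\dots,F_{X_d}(x_d))$, $\boldsymbol{x}\in\mathbb{R}_+^d$, where $C\in\mathcal{C}_d^{FGM}$, and let $\boldsymbol{I}=(I_1,\dots,I_d)$ be a symmetric multivariate Bernoulli random vector representing $C$. Let $S=X_1+\dots+X_d$. Then the Laplace-Stieltjes transform of $S$ is $$\mathcal{L}_S(t)=E_{\boldsymbol{I}}\left[\prod_{k=1}^d \mathcal{L}_{X_{k,[I_k+1]}}(t)\right],\qquad t\ge 0.$$
   Context: $\mathcal{C}_d^{FGM}$ is the class of $d$-variate Farlie-Gumbel-Morgenstern (FGM) copulas, that is, functions $$C(\boldsymbol{u})=\prod_{k=1}^d u_k\left(1+\sum_{k=2}^{d}\sum_{1\le j_1<\cdots<j_k\le d}\theta_{j_1\ldots j_k}\overline{u}_{j_1}\cdots\overline{u}_{j_k}\right),\quad \boldsymbol{u}\in[0,1]^d,\ \overline{u}_j=1-u_j,$$ whose real parameters satisfy $1+\sum_{k=2}^{d}\sum_{1\le j_1<\dots<j_k\le d}\theta_{j_1\dots j_k}\varepsilon_{j_1}\cdots\varepsilon_{j_k}\ge 0$ for all $(\varepsilon_1,\dots,\varepsilon_d)\in\{-1,1\}^d$. A symmetric multivariate Bernoulli random vector is a random vector $\boldsymbol{I}$ with values in $\{0,1\}^d$ such that $\Pr(I_k=0)=\Pr(I_k=1)=1/2$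 for every $k$. It represents $C$ if $$C(\boldsymbol{u})=E_{\boldsymbol{I}}\left[\prod_{k=1}^d F_{U_{[I_k+1]}}(u_k)\right],\quad \boldsymbol{u}\in[0,1]^d,$$ where $F_{U_{[1]}}(u)=1-(1-u)^2$ and $F_{U_{[2]}}(u)=u^2$. It is known that every $C\in\mathcal{C}_d^{FGM}$ is represented by such a vector, and then $\theta_{j_1\ldots j_k}=(-2)^kE_{\boldsymbol{I}}\{\prod_{n=1}^k(I_{j_n}-\tfrac12)\}$. For each $k$, $X_{k,[1]}$ and $X_{k,[2]}$ denote random variables distributed as the minimum and the maximum of two independent copies of $X_k$, i.e. with cdfs $F_{X_{k,[1]}}(x)=1-(1-F_{X_k}(x))^2$ and $F_{X_{k,[2]}}(x)=F_{X_k}(x)^2$. For a nonnegative random variable $Y$, $\mathcal{L}_Y(t)=E[e^{-tY}]$. The notation $E_{\boldsymbol{I}}$ means expectation over $\boldsymbol{I}$, the bracket being regarded as a deterministic function of $\boldsymbol{I}$. *)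

(* Defs.v *)
From HB Require Import structures.
From mathcomp Require Import all_boot all_order all_algebra.
From mathcomp Require Import all_classical all_reals all_analysis.

Set Implicit Arguments.
Unset Strict Implicit.
Unset Printing Implicit Defensive.
Import Order.TTheory GRing.Theory Num.Theory.
Import numFieldNormedType.Exports.
Local Open Scope classical_set_scope.
Local Open Scope ring_scope.

(* The parameter theta_{j_1...j_k}, j_1 < ... < j_k, is indexed by the set
   {j_1, ..., j_k}; only the values on sets of cardinal at least 2 are used. *)
Definition fgm_factor (R : realType) (d : nat) (theta : {set 'I_d} -> R)
    (v : 'I_d -> R) : R :=
  1 + \sum_(2 <= k < d.+1) \sum_(A : {set 'I_d} | #|A| == k)
        theta A * \prod_(j in A) v j.

Definition fgm_admissible (R : realType) (d : nat)
    (theta : {set 'I_d} -> R) : Prop :=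
  forall eps : 'I_d -> R, (forall j, eps j = -1 \/ eps j = 1) ->
    0 <= fgm_factor theta eps.

(* Only the values of C on the unit cube matter. *)
Definition fgm_copula (R : realType) (d : nat) (C : ('I_d -> R) -> R) : Prop :=
  exists2 theta : {set 'I_d} -> R, fgm_admissible theta &
    forall u : 'I_d -> R, (forall k, 0 <= u k <= 1) ->
      C u = (\prod_(k < d) u k) * fgm_factor theta (fun j => 1 - u j).

(* If p = F(x), the value at x of the cdf of the minimum ([b = false]) or of
   the maximum ([b = true]) of two independent variables with cdf F. A boolean b
   stands for the Bernoulli value 0 or 1, hence for the subscript [b + 1]. For
   the uniform distribution, this is F_{U_{[b + 1]}}. *)
Definition minmax_cdf (R : realType) (b : bool) (p : R) : R :=
  if b then p ^+ 2 else 1 - (1 - p) ^+ 2.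

Definition rcdf (R : realType) (dT : measure_display) (T : measurableType dT)
    (P : probability T R) (X : {RV P >-> R}) (x : R) : R :=
  fine (cdf X x).

Definition symmetric_bernoulli (R : realType) (dT : measure_display)
    (T : measurableType dT) (Q : probability T R) (d : nat)
    (I : 'I_d -> {RV Q >-> bool}) : Prop :=
  forall (k : 'I_d) (b : bool), Q (I k @^-1` [set b]) = (2^-1)%:E.

Definition represents (R : realType) (dT : measure_display)
    (T : measurableType dT) (Q : probability T R) (d : nat)
    (I : 'I_d -> {RV Q >-> bool}) (C : ('I_d -> R) -> R) : Prop :=
  forall u : 'I_d -> R, (forall k, 0 <= u k <= 1) ->
    (C u)%:E = 'E_Q[fun w => (\prod_(k < d) minmax_cdf (I k w) (u k))%R]%E.

Definition laplace (R : realType) (dT : measure_display)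
    (T : measurableType dT) (P : probability T R) (Y : T -> R) (t : R) : \bar R :=
  'E_P[fun w => expR (- t * Y w)%R]%E.

(* Main.v *)
Require Import Defs.
From HB Require Import structures.
From mathcomp Require Import all_boot all_order all_algebra.
From mathcomp Require Import all_classical all_reals all_analysis.
From mathcomp Require Import measurable_realfun.

Set Implicit Arguments.
Unset Strict Implicit.
Unset Printing Implicit Defensive.
Import Order.TTheory GRing.Theory Num.Theory.
Import numFieldNormedType.Exports.
Local Open Scope classical_set_scope.
Local Open Scope ring_scope.

(** For [t = 0], where there is no exponential law, both sides are 1. For [t > 0], let [nu] be the exponential law
of rate [t]. Since [expR (- t * x) = nu `[x, +oo[] when [0 <= x],

  exp(- t S) = \prod_k \int[nu]_u 1(X_k <= u),

and by Tonelli the Laplace transform of [X_{k,[b+1]}] at [t] is the integral of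
its cdf against [nu] ([laplace_integral_cdf]). So the two sides are the values
of one and the same construction, [w |-> \prod_k \int[nu]_u A k (w, u)] followed
by integration over [w]: on the left with the indicators of [X_k <= u], on the
right with the cdfs of the [X_{k,[I_k+1]}] seen as functions of [I].

Before the integrations against [nu], that is, with a fixed level [s k] in each
coordinate, the two integrals over [w] are the joint cdf of [X] at [s] and the
mixture of products of cdfs which represents [C], and these agree. The equality
is then carried through the integrations against [nu], one coordinate at a
time, by Tonelli ([eq_integral_prod]). This avoids product measures of
dimension [d]: only the products of two spaces are used. *)

(** * Integrating a product one coordinate at a time *)

Lemma measurable_prode (R : realType) d (T : measurableType d) (D : set T)
    (I : Type) (r : seq I) (p : pred I) (f : I -> T -> \bar R) :
  (forall i, p i -> measurable_fun D (f i)) ->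
  measurable_fun D (fun x => \prod_(i <- r | p i) f i x)%E.
Proof.
move=> mf; elim: r => [|i r ih].
  rewrite (_ : (fun _ => _) = cst 1%E); first exact: measurable_cst.
  by apply/funext => x; rewrite big_nil.
rewrite (_ : (fun _ => _) = fun x => if p i then
    (f i x * \prod_(j <- r | p j) f j x)%E else (\prod_(j <- r | p j) f j x)%E).
  by case: (boolP (p i)) => // pi; apply: emeasurable_funM => //; exact: mf.
by apply/funext => x; rewrite big_cons.
Qed.

Section mixing.
Local Open Scope ereal_scope.
Context (R : realType) (K : finType).
Context dS (S : measurableType dS) (nu : {sigma_finite_measure set S -> \bar R}).

Section one_space.
Context dT (T : measurableType dT) (mu : {sigma_finite_measure set T -> \bar R}).
Variable A : K -> T * S -> \bar R.
Hypothesis mA : forall k, measurable_fun setT (A k).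
Hypothesis A0 : forall k z, 0 <= A k z.

(** The intermediate stage, at coordinate [k], of the induction in
    [eq_integral_prod]: [r] grows from the empty list to all of [K]. *)
Definition mixed (r : seq K) (s : K -> S) (k : K) (w : T) : \bar R :=
  if k \in r then \int[nu]_u A k (w, u) else A k (w, s k).

Lemma mixed_ge0 r s k w : 0 <= mixed r s k w.
Proof. by rewrite /mixed; case: ifP => // _; exact: integral_ge0. Qed.

Lemma measurable_mixed r s k : measurable_fun setT (mixed r s k).
Proof.
rewrite /mixed; case: (k \in r).
  exact: (measurable_fun_fubini_tonelli_F _ (mA k) (A0 k)).
exact: measurableT_comp (mA k) (measurable_fun_pair _ _).
Qed.

(** The induction step. The integral of [A j (w, .)] multiplies a factor which
    depends on [w] only, so that Tonelli on [T * S] applies to it. The right-hand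
    side involves [A] only through the previous stage, at varying levels: an
    equality known there for all levels is transmitted. *)
Lemma integral_prod_mixed_cons j r s : j \notin r ->
  \int[mu]_w \prod_k mixed (j :: r) s k w =
  \int[nu]_u \int[mu]_w \prod_k mixed r (@dfwith K (fun=> S) s j u) k w.
Proof.
move=> jr; pose rest w := \prod_(k | k != j) mixed r s k w.
have mrest : measurable_fun setT rest.
  by apply: measurable_prode => k _; exact: measurable_mixed.
have rest0 w : 0 <= rest w by apply: prode_ge0 => k _; exact: mixed_ge0.
pose f (z : T * S) := rest z.1 * A j z.
have mf : measurable_fun setT f.
  by apply: emeasurable_funM => //; exact: measurableT_comp mrest _.
have f0 z : 0 <= f z by rewrite mule_ge0.
transitivity (\int[mu]_w \int[nu]_u f (w, u)).
  apply: eq_integral => w _; rewrite /f /= ge0_integralZl//; last first.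
    by apply: measurableT_comp => //; exact: measurable_fun_pair.
  rewrite (bigD1 j)//= /mixed mem_head muleC; congr (_ * _).
  by apply: eq_bigr => k kj; rewrite inE (negbTE kj).
rewrite (fubini_tonelli f mf f0); apply: eq_integral => u _.
apply: eq_integral => w _; rewrite /f /= [RHS](bigD1 j)//= muleC.
congr (_ * _); first by rewrite /mixed (negbTE jr) dfwithin.
by apply: eq_bigr => k kj; rewrite /mixed dfwithout// eq_sym.
Qed.

End one_space.

(** Averaging the levels [s k] one after the other preserves the equality,
    since each averaging is the integral against [nu] of the previous stage on
    both sides. The point [s0] is only a starting value for the levels, all of
    which are averaged out in the end. *)
Lemma eq_integral_prod
    dT (T : measurableType dT) (mu : {sigma_finite_measure set T -> \bar R})
    dT' (T' : measurableType dT') (mu' : {sigma_finite_measure set T' -> \bar R})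
    (A : K -> T * S -> \bar R) (B : K -> T' * S -> \bar R) (s0 : K -> S) :
  (forall k, measurable_fun setT (A k)) -> (forall k z, 0 <= A k z) ->
  (forall k, measurable_fun setT (B k)) -> (forall k z, 0 <= B k z) ->
  (forall s : K -> S, \int[mu]_w \prod_k A k (w, s k) =
                      \int[mu']_w \prod_k B k (w, s k)) ->
  \int[mu]_w \prod_k \int[nu]_u A k (w, u) =
  \int[mu']_w \prod_k \int[nu]_u B k (w, u).
Proof.
move=> mA A0 mB B0 AB.
suff mixedE r : uniq r -> forall s, \int[mu]_w \prod_k mixed A r s k w =
                                    \int[mu']_w \prod_k mixed B r s k w.
  have := mixedE _ (enum_uniq K) s0.
  under eq_integral do under eq_bigr do rewrite /mixed mem_enum.
  by under [X in _ = X -> _]eq_integral do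
    under eq_bigr do rewrite /mixed mem_enum.
elim: r => [_ s|j r ih /= /andP[jr ur] s]; first exact: AB.
rewrite !integral_prod_mixed_cons//.
by apply: eq_integral => u _; exact: ih.
Qed.

End mixing.

(** * Laplace transforms as integrals of cdfs *)

Lemma exponential_prob_itvcy (R : realType) (t x : R) : 0 < t -> 0 <= x ->
  exponential_prob t `[x, +oo[%classic = (expR (- t * x))%:E.
Proof.
move=> t0 x0.
have cexp : continuous (fun z : R => - expR (- t * z)).
  move=> z; apply: cvgN; apply: continuous_comp; last exact: continuous_expR.
  by apply: continuousM => //; exact: cst_continuous.
rewrite /exponential_prob.
rewrite (@ge0_continuous_FTC2y _ _ (fun z => - expR (- t * z)) _ 0)//.
- by rewrite add0e EFinN oppeK.
- by move=> z _; exact/exponential_pdf_ge0/ltW.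
- apply: (continuous_subspaceW _ (@within_continuous_exponential_pdf R t)).
  by move=> z /=; rewrite !in_itv/= !andbT; exact: le_trans.
- rewrite -oppr0; apply: cvgN.
  rewrite (_ : (fun z => expR (- t * z)) =
               (fun z => expR (- z)) \o (fun z => t * z)); last first.
    by apply: eq_fun => z; rewrite mulNr.
  apply: (@cvg_comp _ _ _ _ _ _ (pinfty_nbhs R)); last exact: cvgr_expR.
  exact: gt0_cvgMry.
- by apply/cvg_at_right_filter; exact: cexp.
- move=> z; rewrite in_itv/= andbT => xz; apply: derive1_exponential_pdf.
  by rewrite in_itv/= andbT (le_lt_trans x0).
Qed.

(** Packages the exponential law with its sigma-finite structure, which
    depends on the proof of [0 < t]. *)
Lemma ex_exponential_measure (R : realType) (t : R) : 0 < t ->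
  exists nu : {sigma_finite_measure set (measurableTypeR R) -> \bar R},
    forall x : R, 0 <= x -> nu `[x, +oo[%classic = (expR (- t * x))%:E.
Proof.
move=> t0.
exists (exponential_distribution_exponential_prob__canonical__measure_function_SigmaFiniteMeasure t0).
by move=> x x0; exact: exponential_prob_itvcy.
Qed.

Lemma measurable_indic_le (R : realType) d (T : measurableType d) (Y : T -> R) :
  measurable_fun setT Y ->
  measurable_fun setT (fun z : T * measurableTypeR R =>
    (Y z.1 <= (z.2 : R))%R%:R%:E : \bar R).
Proof.
move=> mY; apply/measurable_EFinP.
have mle : measurable_fun setT (fun z : T * measurableTypeR R => Y z.1 <= (z.2 : R)).
  by apply: measurable_fun_ler => //; exact: measurableT_comp mY _.
rewrite (_ : (fun _ => _) = fun z => if Y z.1 <= (z.2 : R) then 1 else 0).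
  exact: measurable_fun_ifT.
by apply/funext => z; case: (_ <= _).
Qed.

Lemma cdfE (R : realType) d (T : measurableType d) (P : probability T R)
  (Y : {RV P >-> R}) x : cdf Y x = (\int[P]_w (Y w <= x)%R%:R%:E)%E.
Proof.
rewrite -[LHS]/(P (Y @^-1` `]-oo, x])) -[Y @^-1` _]setIT -integral_indic//.
  apply: eq_integral => w _; rewrite indicE; congr ((nat_of_bool _)%:R%:E).
  by apply/idP/idP; rewrite inE/= in_itv.
rewrite -[X in measurable X]setTI; exact: (measurable_funPT Y).
Qed.

(** The strict half-line is a countable union of the closed half-lines on
    which the cdf gives information. *)
Lemma negligible_lt0 (R : realType) d (T : measurableType d)
    (P : probability T R) (Y : {RV P >-> R}) :
  (forall x, x < 0 -> cdf Y x = 0%E) -> P.-negligible [set w | Y w < 0].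
Proof.
move=> Y0.
have neg n : P.-negligible [set w | Y w <= - n.+1%:R^-1].
  rewrite (_ : [set w | _] = Y @^-1` `]-oo, - n.+1%:R^-1]); last first.
    by apply/seteqP; split=> w /=; rewrite in_itv.
  apply/negligibleP; last by apply: Y0; rewrite oppr_lt0 invr_gt0.
  by rewrite -[X in measurable X]setTI; exact: (measurable_funPT Y).
apply: negligibleS (negligible_bigcup neg) => w /= Yw0.
have /ltr_add_invr[n] : 0 < - Y w by rewrite oppr_gt0.
by rewrite add0r => nY; exists n => //=; rewrite lerNr ltW.
Qed.

Lemma integral_indic_ge (R : realType) (x : R)
    (nu : {measure set (measurableTypeR R) -> \bar R}) :
  (\int[nu]_u (x <= (u : R))%R%:R%:E)%E = nu `[x, +oo[%classic.
Proof.
rewrite -[X in nu X]setIT -integral_indic//.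
apply: eq_integral => u _; rewrite indicE; congr ((nat_of_bool _)%:R%:E).
by apply/idP/idP; rewrite inE/= in_itv/= andbT.
Qed.

Lemma laplace0 (R : realType) d (T : measurableType d)
    (P : probability T R) (Y : T -> R) : laplace P Y 0 = 1%E.
Proof.
rewrite /laplace unlock -(@probability_setT _ _ _ P) -[RHS]mul1e -integral_cst//.
by apply: eq_integral => w _; rewrite oppr0 mul0r expR0.
Qed.

(** Both sides are integrals of the indicator of [Y w <= u] over [(w, u)], in
    the two orders. The identity [nu `[y, +oo[ = expR (- t * y)] is only
    available for [0 <= y]; the first hypothesis says that [Y] is nonnegative
    almost surely, in the form in which it is known for the minimum and the
    maximum. *)
Lemma laplace_integral_cdf (R : realType) d (T : measurableType d)
    (P : probability T R) (Y : {RV P >-> R}) (t : R)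
    (nu : {sigma_finite_measure set (measurableTypeR R) -> \bar R}) :
  (forall x, x < 0 -> cdf Y x = 0%E) ->
  (forall x : R, 0 <= x -> nu `[x, +oo[%classic = (expR (- t * x))%:E) ->
  laplace P Y t = (\int[nu]_s cdf Y s)%E.
Proof.
move=> Y0 nuE; rewrite /laplace unlock.
pose f (z : T * measurableTypeR R) : \bar R := (Y z.1 <= (z.2 : R))%R%:R%:E.
have mf : measurable_fun setT f := measurable_indic_le (measurable_funPT Y).
have f0 z : (0 <= f z)%E by rewrite lee_fin.
under [RHS]eq_integral do rewrite cdfE.
rewrite -(fubini_tonelli f mf f0).
apply: ge0_ae_eq_integral => //.
- apply/measurable_EFinP; apply: measurableT_comp => //.
  by apply: measurable_funM => //; exact: measurable_funPT.
- exact: measurable_fun_fubini_tonelli_F.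
- by move=> w _; exact: integral_ge0.
apply: negligibleS (negligible_lt0 Y0) => w /= nfw.
rewrite ltNge; apply/negP => Yw0; apply: nfw => _.
by rewrite /= -nuE// -integral_indic_ge.
Qed.

(** * The theorem *)

Lemma minmax_cdf0 (R : realType) b : minmax_cdf b 0 = 0 :> R.
Proof. by rewrite /minmax_cdf; case: b; rewrite ?expr0n// subr0 expr1n subrr. Qed.

Lemma rcdf_itv01 (R : realType) d (T : measurableType d)
  (P : probability T R) (Y : {RV P >-> R}) x : 0 <= rcdf Y x <= 1.
Proof. by rewrite /rcdf fine_ge0//= -lee_fin fineK ?fin_num_measure// cdf_le1. Qed.

Lemma rcdf_lt0 (R : realType) d (T : measurableType d) (P : probability T R)
    (Y : {RV P >-> R}) x :
  (forall w, 0 <= Y w) -> x < 0 -> rcdf Y x = 0.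
Proof.
move=> Y0 x0; rewrite /rcdf -[cdf _ _]/(P (Y @^-1` `]-oo, x])).
suff -> : Y @^-1` `]-oo, x] = set0 by rewrite measure0.
rewrite -subset0 => w /=; rewrite in_itv/= => /(le_trans (Y0 w)).
by rewrite leNgt x0.
Qed.

(* X, I and each X_{k,[b+1]} = Y k b may live on different probability spaces. *)
Theorem theorem3 (R : realType) (d : nat) (hd : (2 <= d)%N)
    (dX : measure_display) (TX : measurableType dX) (P : probability TX R)
    (X : 'I_d -> {RV P >-> R})
    (hX : forall (k : 'I_d) (w : TX), 0 <= X k w)
    (C : ('I_d -> R) -> R) (hC : fgm_copula C)
    (hXC : forall x : 'I_d -> R, (forall k, 0 <= x k) ->
       P [set w | forall k, X k w <= x k] = (C (fun k => rcdf (X k) (x k)))%:E)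
    (dI : measure_display) (TI : measurableType dI) (Q : probability TI R)
    (I : 'I_d -> {RV Q >-> bool})
    (hI : symmetric_bernoulli I) (hIC : represents I C)
    (dY : 'I_d -> bool -> measure_display)
    (TY : forall (k : 'I_d) (b : bool), measurableType (dY k b))
    (PY : forall (k : 'I_d) (b : bool), probability (TY k b) R)
    (Y : forall (k : 'I_d) (b : bool), {RV (PY k b) >-> R})
    (hY : forall (k : 'I_d) (b : bool) (x : R),
       rcdf (Y k b) x = minmax_cdf b (rcdf (X k) x))
    (t : R) (ht : 0 <= t) :
  laplace P (fun w => \sum_(k < d) X k w) t =
  (\int[Q]_w (\prod_(k < d) laplace (PY k (I k w)) (Y k (I k w)) t))%E.
Proof.
have cdfYE k b x : cdf (Y k b) x = (minmax_cdf b (rcdf (X k) x))%:E.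
  by rewrite -hY /rcdf fineK// fin_num_measure.
have cdfY0 k b x : x < 0 -> cdf (Y k b) x = 0%E.
  by move=> x0; rewrite cdfYE rcdf_lt0// minmax_cdf0.
have [t0|] := ltP 0 t; last first.
  move=> t0; have {t0} -> : t = 0 by apply/eqP; rewrite eq_le t0.
  rewrite laplace0; transitivity (\int[Q]_w (1 : \bar R))%E.
    by rewrite integral_cst// mul1e; exact/esym/probability_setT.
  by apply: eq_integral => w _; rewrite big1// => k _; rewrite laplace0.
have [nu nuE] := ex_exponential_measure t0.
pose A k (z : TX * measurableTypeR R) : \bar R := (X k z.1 <= (z.2 : R))%R%:R%:E.
pose B k (z : TI * measurableTypeR R) : \bar R := cdf (Y k (I k z.1)) z.2.
transitivity (\int[P]_w \prod_k \int[nu]_u A k (w, u))%E.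
  rewrite /laplace unlock; apply: eq_integral => w _.
  rewrite mulr_sumr expR_sum -prodEFin; apply: eq_bigr => k _.
  by rewrite -nuE// -integral_indic_ge.
transitivity (\int[Q]_w \prod_k \int[nu]_u B k (w, u))%E; last first.
  apply: eq_integral => w _; apply: eq_bigr => k _.
  by rewrite (laplace_integral_cdf (cdfY0 k (I k w)) nuE).
apply: (@eq_integral_prod R 'I_d _ _ nu _ _ P _ _ Q A B (fun=> 0)).
- by move=> k; exact: measurable_indic_le.
- by move=> k z; rewrite lee_fin.
- move=> k; rewrite (_ : B k = fun z => if I k z.1 then cdf (Y k true) z.2
                                        else cdf (Y k false) z.2).
    apply: measurable_fun_ifT.
    + by apply: (measurableT_comp (measurable_funPT (I k))).
    + by apply: (measurableT_comp (cdf_measurable _)).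
    + by apply: (measurableT_comp (cdf_measurable _)).
  by apply/funext => z; rewrite /B; case: (I k z.1).
- by move=> k z; exact: cdf_ge0.
move=> s.
(* A product of indicators is the indicator of the joint event. *)
transitivity (P [set w | forall k, X k w <= s k]).
  rewrite -[X in P X]setIT -integral_indic//.
  - apply: eq_integral => w _; rewrite prodEFin indicE; congr (_%:E).
    have [Xs|/existsNP[k Xks]] := pselect (forall k, X k w <= s k).
      by rewrite mem_set// big1// => k _; rewrite Xs.
    rewrite memNset; last by move=> Xs; apply: Xks; exact: Xs.
    by rewrite (bigD1 k)//= (negbTE (introN idP Xks)) mul0r.
  - rewrite (_ : [set w | _] = \bigcap_(k in [set: 'I_d]) [set w | X k w <= s k]).
      apply: fin_bigcap_measurable => // k _.
      rewrite (_ : [set w | _] = X k @^-1` `]-oo, s k]); last first.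
        by apply/seteqP; split=> w /=; rewrite in_itv.
      by rewrite -[X in measurable X]setTI; exact: (measurable_funPT (X k)).
    by apply/seteqP; split=> w /= Xs k => [_|]; apply: Xs.
have [s0|/existsNP[k /negP]] := pselect (forall k, 0 <= s k).
  rewrite hXC// hIC => [|k]; last exact: rcdf_itv01.
  rewrite unlock; apply: eq_integral => w _.
  by rewrite -prodEFin; apply: eq_bigr => k _; rewrite /B cdfYE.
(* The cdf hypothesis covers nonnegative levels only, but both integrals vanish
   as soon as one level is negative. *)
rewrite -ltNge => sk0; rewrite (_ : [set w | _] = set0) ?measure0; last first.
  rewrite -subset0 => w /= /(_ k) /(le_trans (hX k w)).
  by rewrite leNgt sk0.
rewrite (@eq_integral _ _ _ _ _ (cst 0%E)) ?integral0// => w _.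
by rewrite (bigD1 k)//= /B cdfY0// mul0e.
Qed.
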